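(* Let $(X,d)$ be a compact metric space, let $f:X\to X$ be a continuous map with the specification property, and let $\varphi\in C(X,\mathbb R)$. For $\alpha\in\mathbb R$ let $K_\alpha=\{x\in X:\lim_{n\to\infty}\frac1n\sum_{j=0}^{n-1}\varphi(f^j(x))=\alpha\}$, and let $\mathcal L_\varphi=\{\alpha\in\mathbb R:K_\alpha\neq\emptyset\}$ (which is an interval). Then the map $$\mathcal L_\varphi\ni\alpha\mapsto\underline{\mathrm{mdim}}_M(K_\alpha,f,d)$$ is concave.
   Context: $C(X,\mathbb R)$ is the set of continuous functions $X\to\mathbb R$. For $n\in\mathbb N$, $d_n(x,z)=\max_{0\le i\le n-1}d(f^i(x),f^i(z))$; for $\varepsilon>0$, $B_n(x,\varepsilon)=\{y\in X:d_n(x,y)<\varepsilon\}$. Specification property. $f$ satisfies the specification property if for every $\epsilon>0$ there is an integer $m=m(\epsilon)$ such that for any finite collection of finite intervals $I_j=[a_j,b_j]\subset\mathbb N$, $j=1,\dots,k$, with $a_{j+1}-b_j\ge m(\epsilon)$ for $j=1,\dots,k-1$, and any $x_1,\dots,x_k\in X$, there is $x\in X$ with $d(f^{p+a_j}(x),f^p(x_j))<\epsilon$ for all $p=0,\dots,b_j-a_j$ and all $j=1,\dots,k$. Lower metric mean dimension of a subset. For $Z\subset X$, $s\in\mathbb R$, $N\in\mathbb N$, $\varepsilon>0$ let $m(Z,s,N,\varepsilon)=\inf_\Gamma\sum_{i\in I}\exp(-sn_i)$, the infimum being over all covers $\Gamma=\{B_{n_i}(x_i,\varepsilon)\}_{i\in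 I}$ of $Z$ with all $n_i\ge N$. Put $m(Z,s,\varepsilon)=\lim_{N\to\infty}m(Z,s,N,\varepsilon)$. There is a critical value $s_0\in[0,+\infty)$ with $m(Z,s,\varepsilon)=0$ for $s>s_0$ and $m(Z,s,\varepsilon)=+\infty$ for $s<s_0$; it is denoted $h(Z,f,\varepsilon)=\inf\{s:m(Z,s,\varepsilon)=0\}=\sup\{s:m(Z,s,\varepsilon)=+\infty\}$. Then $\underline{\mathrm{mdim}}_M(Z,f,d)=\liminf_{\varepsilon\to0}\frac{h(Z,f,\varepsilon)}{|\log\varepsilon|}\in[0,+\infty]$. Concavity of a map $g:\mathcal L_\varphi\to[0,+\infty]$ means $t\,g(\alpha_1)+(1-t)\,g(\alpha_2)\le g(t\alpha_1+(1-t)\alpha_2)$ for all $\alpha_1,\alpha_2\in\mathcal L_\varphi$ and $t\in[0,1]$ (with $0\cdot\infty=0$). *)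

(* Defs.v *)
From HB Require Import structures.
From mathcomp Require Import all_boot all_order all_algebra.
From mathcomp Require Import all_classical all_reals all_analysis.

Set Implicit Arguments.
Unset Strict Implicit.
Unset Printing Implicit Defensive.

Import Order.TTheory GRing.Theory Num.Theory.
Import numFieldNormedType.Exports.

Local Open Scope classical_set_scope.
Local Open Scope ring_scope.

(* The maximum over the empty range is 0, so d_0 = 0; since d >= 0 the default
   value 0 has no effect when n > 0. *)
Definition dyn_dist (R : realType) (X : metricType R) (f : X -> X) (n : nat)
    (x z : X) : R :=
  \big[Num.max/0]_(i < n) mdist (iter i f x) (iter i f z).

Definition dyn_ball (R : realType) (X : metricType R) (f : X -> X) (n : nat)
    (x : X) (e : R) : set X :=
  [set y | dyn_dist f n x y < e].

(* The k intervals [a_j, b_j] and points x_j are indexed by j < k; values of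
   a, b and x at indices j >= k are irrelevant.  The gap condition is written
   b_j + m <= a_(j+1) to avoid truncated subtraction. *)
Definition specification (R : realType) (X : metricType R) (f : X -> X) : Prop :=
  forall e : R, 0 < e ->
  exists m : nat,
  forall (k : nat) (a b : nat -> nat) (x : nat -> X),
    (0 < k)%N ->
    (forall j, (j < k)%N -> (a j <= b j)%N) ->
    (forall j, (j.+1 < k)%N -> (b j + m <= a j.+1)%N) ->
    exists y : X, forall j p, (j < k)%N -> (p <= b j - a j)%N ->
      mdist (iter (p + a j) f y) (iter p f (x j)) < e.

(* A family {B_(n_i)(x_i, e)}_i of dynamical balls is given by the set G of its
   pairs (x_i, n_i). *)
Definition dyn_cover (R : realType) (X : metricType R) (f : X -> X)
    (Z : set X) (N : nat) (e : R) (G : set (X * nat)) : Prop :=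
  (forall c, G c -> (N <= c.2)%N) /\
  Z `<=` \bigcup_(c in G) dyn_ball f c.2 c.1 e.

Definition cover_sum (R : realType) (X : metricType R) (f : X -> X)
    (Z : set X) (s : R) (N : nat) (e : R) : \bar R :=
  ereal_inf [set \esum_(c in G) (expR (- s * c.2%:R))%:E |
              G in dyn_cover f Z N e].

Definition cover_lim (R : realType) (X : metricType R) (f : X -> X)
    (Z : set X) (s e : R) : \bar R :=
  limn (fun N => cover_sum f Z s N e).

(* For Z = set0 the infimum runs over all reals and is -oo. *)
Definition entropy_at (R : realType) (X : metricType R) (f : X -> X)
    (Z : set X) (e : R) : \bar R :=
  ereal_inf [set s%:E | s in [set s : R | cover_lim f Z s e = 0%E]].

Definition lower_mdim (R : realType) (X : metricType R) (f : X -> X)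
    (Z : set X) : \bar R :=
  limf_einf (fun e : R => (entropy_at f Z e * (`|ln e|^-1)%:E)%E) (0 : R)^'+.

Definition level_set (R : realType) (X : metricType R) (f : X -> X)
    (phi : X -> R) (alpha : R) : set X :=
  [set x | (fun n : nat => n%:R^-1 * \sum_(0 <= j < n) phi (iter j f x))
             @ \oo --> alpha].

Definition level_values (R : realType) (X : metricType R) (f : X -> X)
    (phi : X -> R) : set R :=
  [set alpha | level_set f phi alpha !=set0].

Definition concave_on (R : realType) (L : set R) (g : R -> \bar R) : Prop :=
  forall (a1 a2 t : R), L a1 -> L a2 -> 0 <= t <= 1 ->
    (t%:E * g a1 + (1 - t)%:E * g a2 <= g (t * a1 + (1 - t) * a2)%R)%E.

(* Main.v *)
Require Import Defs.
From HB Require Import structures.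
From mathcomp Require Import all_boot all_order all_algebra.
From mathcomp Require Import all_classical all_reals all_analysis.
From mathcomp Require Import lra zify ring.
Import Order.TTheory GRing.Theory Num.Theory.
Import numFieldNormedType.Exports.
Local Open Scope classical_set_scope.
Local Open Scope ring_scope.

Set Implicit Arguments.
Unset Strict Implicit.
Unset Printing Implicit Defensive.

(** The proof compares, at each fixed scale [e], the Bowen-type entropy of a
    level set with a cruder quantity. Say that [a] is [rich] with rate [s] at
    scale [e] if for every tolerance [d] and all large [n] there are at least
    [expR (s * n)] points which are [(n, e)]-separated and whose [n]-step
    Birkhoff averages are within [d] of [a].

    - If [s] is below the entropy of the level set of [a] at scale [e], then [a]
      is rich with rate [s] ([rich_of_entropy]). A point of the level set has
      good averages at all large times; if at infinitely many times [n] there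
      were fewer than [expR (s * n)] separated points with good averages,
      maximal separated sets at these times would be too cheap a cover.

    - Richness is concave up to halving the scale ([rich_convex]): by
      specification, an orbit can follow a good orbit for [a1] during a
      proportion [t] of the time and then a good orbit for [a2]; the numbers of
      choices multiply and the Birkhoff sums add.

    - If [a] is rich with rate [s] at scale [e], then its level set is nonempty
      and has entropy at least [s] at scale [e / 4] ([moran]). One concatenates
      infinitely many words, chosen freely from finite separated sets [E k],
      and follows them by a single orbit. Stage [k] uses words of length
      [len k], gaps of length [gap k] negligible with respect to [len k], and
      following precision [c / 2 ^ k]; since the precision tends to [0], the
      Birkhoff averages converge to [a] ([infinite_trace], [traced_average]).
      Each stage is repeated until a block of the next one is short in
      comparison with the elapsed time ([slow_schedule]), so that averages and
      counts are controlled at every time and not only at the ends of blocks.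
      A dynamical ball of length [n] determines all the words completed before
      time [n], hence corresponds to a cylinder of the tree of choices, of mass
      at most [expR (- s' * n)] for [s' < s]; and cylinders which cover the tree
      have total mass at least [1] ([tree_cover]).

    Together, the entropy at scale [e / 8] of the level set of a convex
    combination dominates the convex combination of the entropies at scale [e]
    ([entropy_concave]). Dividing by [|ln e|] makes the factor [8] harmless in
    the limit, and the lower limit is superadditive ([lower_mdim_concave]). The
    middle points of [level_values] are obtained in the same way, starting from
    the rate [0] of a nonempty level set ([level_set_convex]). *)

(** * Covers of an infinite product tree *)

Section tree.
Variables (R : realType) (I : choiceType) (q : nat -> nat).
Variables (G : set I) (A : I -> set (nat -> nat)) (j : I -> nat) (g : I -> R).
Hypothesis q_gt0 : forall i, (0 < q i)%N.
Hypothesis g_ge : forall c, G c -> \prod_(i < j c) (q i)%:R^-1 <= g c.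
Hypothesis A_det : forall c w w', G c -> A c w -> A c w' ->
  forall i, (i < j c)%N -> w i = w' i.

Let mass l : R := \prod_(i < l) (q i)%:R^-1.
Let cyl (w : nat -> nat) l : set I :=
  [set c | G c /\ exists2 w', A c w' & forall i, (i < l)%N -> w' i = w i].
(* Lightness is the invariant of a greedy descent: the members of the family that
   meet a light cylinder are too small in total to cover it. *)
Let light w l := (\esum_(c in cyl w l) (g c)%:E < (mass l)%:E)%E.
Let upd (w : nat -> nat) l v := fun i => if i == l then v else w i.

Let mass_gt0 l : 0 < mass l.
Proof. by apply: prodr_gt0 => i _; rewrite invr_gt0 ltr0n. Qed.

Let g_ge0 c : G c -> 0 <= g c.
Proof. by move=> /g_ge; apply: le_trans; exact/ltW/mass_gt0. Qed.

Let light_depth w l c : light w l -> cyl w l c -> (l < j c)%N.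
Proof.
move=> lw cc; rewrite ltnNge; apply/negP => jl.
move: lw; rewrite /light ltNge => /negP; apply.
apply: (@le_trans _ _ (g c)%:E).
  rewrite lee_fin; apply: le_trans (g_ge cc.1).
  rewrite /mass -(subnKC jl) big_split_ord /= ler_piMr ?prodr_ge0//.
  by apply: prodr_ile1 => i; rewrite invr_ge0 ler0n invf_le1 ?ltr0n ?ler1n ?q_gt0.
rewrite -(@esum_set1 _ _ c (fun x => (g x)%:E)) ?lee_fin ?g_ge0//; last exact: cc.1.
apply: esum_ge; exists [set c]; last first.
  by rewrite esum_set1 ?fsbig_set1 ?lee_fin ?g_ge0//; exact: cc.1.
by split => // x ->.
Qed.

(* The masses of the children of a cylinder add up to its mass and, by
   [A_det], each member of the family meets at most one child; so the children
   cannot all be heavy. *)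
Let light_child w l : light w l -> exists2 v, (v < q l)%N & light (upd w l v) l.+1.
Proof.
move=> lw; apply: contrapT => /forall2NP nv.
move: (lw); rewrite /light ltNge => /negP; apply.
have -> : mass l = \sum_(v < q l) mass l.+1.
  rewrite sumr_const card_ord /mass big_ord_recr /= -[RHS]mulr_natr divfK//.
  by rewrite pnatr_eq0 -lt0n.
rewrite -sumEFin.
apply: (@le_trans _ _ (\sum_(v < q l) \esum_(c in cyl (upd w l v) l.+1) (g c)%:E)%E).
  apply: lee_sum => v _.
  by have [//|/negP] := nv v; rewrite -leNgt.
have sub (v : 'I_(q l)) : cyl (upd w l v) l.+1 = G `&` cyl (upd w l v) l.+1.
  by rewrite setIidr// => c [].
under eq_bigr do rewrite sub esum_mkcondr.
rewrite -esum_sum; last by move=> c v Gc _; case: ifP => // _; rewrite lee_fin g_ge0.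
have -> : cyl w l = G `&` cyl w l by rewrite setIidr// => c [].
rewrite [leRHS]esum_mkcondr; apply: le_esum => c Gc.
case: (pselect (exists v : 'I_(q l), cyl (upd w l v) l.+1 c)); last first.
  move=> /forallNP nex; rewrite big1; last first.
    by move=> v _; rewrite ifF//; apply/negbTE; rewrite notin_setE; exact: nex.
  by case: ifP => // _; rewrite lee_fin g_ge0.
move=> [v cv].
have cw : cyl w l c.
  case: cv => _ [w' Aw' ww']; split => //; exists w' => // i il.
  by rewrite ww' ?(ltn_trans il)// /upd ltn_eqF.
rewrite (bigD1 v)//= big1 ?adde0; last first.
  move=> v' v'v; rewrite ifF//; apply/negbTE; rewrite notin_setE => cv'.
  move: v'v => /eqP; apply; apply: val_inj => /=.
  case: cv' => _ [w1 A1 /(_ l (ltnSn _))].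
  case: cv => _ [w2 A2 /(_ l (ltnSn _))]; rewrite /upd eqxx => <- <-.
  exact: (A_det Gc A1 A2 (light_depth lw cw)).
by rewrite !ifT ?inE.
Qed.

(** If the total weight were below [1], the root would be light; descending
    forever to light children yields a branch [w] which lies in no member [c] of
    the family, because at depth [j c] the weight of [c] alone makes the cylinder
    of [w] heavy. *)
Lemma tree_cover :
  (forall w, (forall i, (w i < q i)%N) -> exists2 c, G c & A c w) ->
  (1 <= \esum_(c in G) (g c)%:E)%E.
Proof.
move=> cov; rewrite leNgt; apply/negP => small.
have step wl : exists v, light wl.1 wl.2 ->
    (v < q wl.2)%N /\ light (upd wl.1 wl.2 v) wl.2.+1.
  have [lw|nlw] := pselect (light wl.1 wl.2); last by exists 0%N.
  by have [v ? ?] := light_child lw; exists v.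
have [s sP] := choice step.
pose W := fix W l := if l is l'.+1 then upd (W l') l' (s (W l', l')) else fun=> 0%N.
have Wl l : light (W l) l.
  elim: l => [|l ih] /=; last exact: (sP (W l, l) ih).2.
  rewrite /light /mass big_ord0; apply: le_lt_trans small.
  have -> : cyl (W 0%N) 0 = G `&` cyl (W 0%N) 0 by rewrite setIidr// => c [].
  rewrite esum_mkcondr; apply: le_esum => c Gc.
  by case: ifP => // _; rewrite lee_fin g_ge0.
pose w i := W i.+1 i.
have wW l i : (i < l)%N -> w i = W l i.
  elim: l => // l ih; rewrite ltnS leq_eqVlt => /predU1P[->//|il].
  by rewrite ih//= /upd ltn_eqF.
have wq i : (w i < q i)%N by rewrite /w /= /upd eqxx; exact: (sP (W i, i) (Wl i)).1.
have [c Gc Ac] := cov w wq.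
have := @light_depth (W (j c)) (j c) c (Wl _); rewrite ltnn => /(_ _)/negP; apply.
  by split => //; exists w => // i; exact: wW.
by [].
Qed.

End tree.

(** * Slowly changing stages *)

Section schedule.
Variable B : nat -> nat.
Hypothesis B_gt0 : forall k, (0 < B k)%N.

(** A block of stage [k] lasts [B k]. Passing to stage [k + 1] only once the
    elapsed time exceeds [(k + 1) * B (k + 1)] keeps each block short with
    respect to its starting time. *)
Lemma slow_schedule : exists kap : nat -> nat,
  [/\ {homo kap : i j / (i <= j)%N},
      forall K, exists J, forall j, (J <= j)%N -> (K <= kap j)%N &
      forall j, (kap j * B (kap j) <= \sum_(i < j) B (kap i))%N].
Proof.
(* the state is the pair of the current stage and the elapsed time *)
pose next (ka : nat * nat) :=
  let a := (ka.2 + B ka.1)%N in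
  (if (ka.1.+1 * B ka.1.+1 <= a)%N then ka.1.+1 else ka.1, a).
pose st j := iter j next (0%N, 0%N).
pose kap j := (st j).1.
have stE j : (st j).2 = (\sum_(i < j) B (kap i))%N.
  by elim: j => [|j ih]; rewrite ?big_ord0// big_ord_recr /= -ih.
have mono j : (kap j <= kap j.+1)%N by rewrite /kap/=; case: ifP.
have homo : {homo kap : i j / (i <= j)%N} by apply: homo_leq => //; exact: leq_trans.
have ge_a j : (j <= (st j).2)%N.
  by elim: j => //= j ih; rewrite -addn1 leq_add.
exists kap; split => //; last first.
  move=> j; rewrite -stE; elim: j => [|j ih]; first by rewrite /kap /= mul0n.
  rewrite {1 2}/kap /=; case: ifP => //= _.
  by apply: (leq_trans ih); rewrite leq_addr.
elim=> [|K [J ihK]]; first by exists 0%N.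
pose J' := maxn J (K.+1 * B K.+1).
exists J'.+1 => j J'j; apply: leq_trans (homo _ _ J'j).
have JJ' : (J <= J')%N by rewrite leq_maxl.
have := ihK _ JJ'; rewrite leq_eqVlt => /predU1P[KJ|]; last by move/leq_trans; apply.
rewrite /kap/=; rewrite -/(kap J') -KJ ifT//.
by apply: leq_trans (leq_addr _ _); apply: leq_trans (ge_a _); rewrite leq_maxr.
Qed.

End schedule.

(** The finitely many blocks with a large error contribute a constant, which
    becomes negligible since the total length is unbounded. *)
Lemma weighted_cesaro (R : realType) (b : nat -> nat) (u : nat -> R) :
  (forall i, (0 < b i)%N) ->
  (forall e, 0 < e -> exists J, forall i, (J <= i)%N -> u i <= e * (b i)%:R) ->
  forall e, 0 < e -> exists J, forall j, (J <= j)%N ->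
    \sum_(i < j) u i <= e * (\sum_(i < j) b i)%:R.
Proof.
move=> b0 ub e e0; have e20 : 0 < e / 2 by rewrite divr_gt0.
have [J JP] := ub _ e20.
pose C := \sum_(i < J) `|u i|.
have C0 : 0 <= C by rewrite sumr_ge0.
have aj j : (j <= \sum_(i < j) b i)%N.
  by rewrite -[X in (X <= _)%N]card_ord -sum1_card leq_sum.
have key j : \sum_(i < j) u i <= C + e / 2 * (\sum_(i < j) b i)%:R.
  elim: j => [|j ih]; first by rewrite !big_ord0 mulr0 addr0.
  have [Jj|jJ] := leqP J j.
    by rewrite !big_ord_recr /= natrD mulrDr addrA lerD// JP.
  apply: (@le_trans _ _ C); last by rewrite lerDl mulr_ge0// ltW.
  rewrite /C -(subnKC jJ) [leRHS]big_split_ord/= -[leLHS]addr0 lerD ?sumr_ge0//.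
  by apply: ler_sum => i _; rewrite ler_norm.
exists (maxn J (Num.trunc (2 * C / e)).+1) => j; rewrite geq_max => /andP[_ Hj].
apply: le_trans (key j) _.
have : 2 * C / e <= (\sum_(i < j) b i)%:R.
  apply: (@le_trans _ _ j%:R); last by rewrite ler_nat.
  by apply: le_trans (ltW (truncnS_gt _)) _; rewrite ler_nat.
rewrite ler_pdivrMr// => h; lra.
Qed.

(** * Compactness and Bowen metrics *)

Section compactness.
Variables (R : realType) (X : metricType R).
Hypothesis cX : compact [set: X].

Lemma compact_unif_cont (phi : X -> R) : continuous phi ->
  forall e, 0 < e -> exists2 d, 0 < d &
    forall x y, mdist x y < d -> `|phi x - phi y| < e.
Proof.
move=> cphi e e0.
have /compact_near_coveringP := cX.
move=> /(_ R (0 : R)^'+ (fun d x => forall y, mdist x y < d -> `|phi x - phi y| < e)).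
case => [x _|d /= d0 H].
  have e20 : 0 < e / 2 by rewrite divr_gt0.
  have /cvgrPdist_lt/(_ _ e20) := cphi x.
  move=> /metricType_numDomainType.nbhs_mdistP [d /= d0 dP].
  exists ([set x' | mdist x x' < d / 2], [set t | t < d / 2]) => /=.
    split; last by apply: nbhs_right_lt; rewrite divr_gt0.
    by apply/metricType_numDomainType.nbhs_mdistP; exists (d / 2) => //=; rewrite divr_gt0.
  move=> [x' t] /= [xx' td] y x'y.
  have xy : mdist x y < d.
    apply: le_lt_trans (metric_triangle _ x' _) _; lra.
  have xx'd : mdist x x' < d by apply: lt_trans xx' _; lra.
  have := dP _ xy; have := dP _ xx'd.
  rewrite /= !ltr_norml => /andP[h1 h2] /andP[h3 h4]; apply/andP; split; lra.
exists (d / 2); first by rewrite divr_gt0.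
move=> x y xy; apply: (H (d / 2)) => //=; last by rewrite divr_gt0.
by rewrite sub0r normrN gtr0_norm ?divr_gt0//; lra.
Qed.

Lemma compact_fun_bounded (phi : X -> R) : continuous phi ->
  exists2 M, 0 < M & forall x, `|phi x| <= M.
Proof.
move=> cphi.
have := @continuous_compact _ _ phi setT (continuous_subspaceT cphi) cX.
move=> /compact_bounded [M [Mr MP]].
exists (`|M| + 1) => [|x]; first by rewrite ltr_wpDl.
by apply: MP; [rewrite (le_lt_trans (ler_norm _))// ltrDl|exists x].
Qed.

Lemma iter_continuous (f : X -> X) n : continuous f -> continuous (iter n f).
Proof.
move=> cf; elim: n => [|n ih] x; first exact: cvg_id.
by apply: (@continuous_comp _ _ _ (iter n f) f); [exact: ih|exact: cf].
Qed.

End compactness.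

Section bowen_metric.
Variables (R : realType) (X : metricType R) (f : X -> X).

Lemma dyn_dist_ltP n x y e : 0 < e ->
  (dyn_dist f n x y < e) <->
  (forall i, (i < n)%N -> mdist (iter i f x) (iter i f y) < e).
Proof.
move=> e0; split => [/bigmax_ltP[_ H] i ni|H].
  exact: (H (Ordinal ni)).
by apply/bigmax_ltP; split => // i _; exact: H.
Qed.

Lemma dyn_dist_sym n x y : dyn_dist f n x y = dyn_dist f n y x.
Proof. by apply: eq_bigr => i _; rewrite metric_sym. Qed.

Definition separated n e (E : seq X) :=
  uniq E /\ {in E &, forall x y, x != y -> e <= dyn_dist f n x y}.

(** No point can be added to a separated set of maximal size. *)
Lemma maximal_separated n e (P : set X) (K : R) : 0 < e ->
  (forall E, separated n e E -> [set` E] `<=` P -> (size E)%:R <= K) ->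
  exists E, [/\ separated n e E, [set` E] `<=` P &
    forall x, P x -> exists2 y, y \in E & dyn_dist f n y x < e].
Proof.
move=> e0 bnd.
pose ok k := `[< exists E, [/\ separated n e E, [set` E] `<=` P & size E = k] >].
have ok0 : ok 0%N by apply/asboolP; exists [::]; split.
have okK k : ok k -> (k <= Num.trunc K)%N.
  move=> /asboolP[E [sE EP <-]]; have := bnd _ sE EP => h.
  by rewrite truncn_ge_nat// (le_trans _ h).
have exok : exists k, ok k by exists 0%N.
have [k /asboolP[E [sE EP Ek]] kmax] := ex_maxnP exok okK.
exists E; split => // x Px; apply: contrapT => /forall2NP nx.
have far y : y \in E -> e <= dyn_dist f n y x.
  by move=> yE; have [//|/negP] := nx y; rewrite -leNgt.
suff /kmax : ok k.+1 by rewrite ltnn.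
apply/asboolP; exists (x :: E); split => /=; last by rewrite Ek.
  case: sE => uE sE; split.
    rewrite /= uE andbT; apply/negP => /far; rewrite leNgt => /negP; apply.
    by apply/(dyn_dist_ltP n x x e0) => i _; rewrite mdistxx.
  move=> y z; rewrite !inE => /predU1P[->|yE] /predU1P[->|zE]; rewrite ?eqxx//.
  - by rewrite dyn_dist_sym => _; exact: far.
  - by move=> _; exact: far.
  - exact: sE.
by move=> y /=; rewrite inE => /predU1P[->//|]; exact: EP.
Qed.

End bowen_metric.

(** * Bounds on the entropy at a fixed scale *)

Section entropy.
Variables (R : realType) (X : metricType R) (f : X -> X).
Implicit Types (Z : set X) (G : set (X * nat)) (s e : R).

Definition weight s (c : X * nat) : R := expR (- s * c.2%:R).

Lemma cover_sum_ge0 Z s N e : (0 <= cover_sum f Z s N e)%E.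
Proof.
apply: le_ereal_inf_tmp => _ [G _ <-].
by apply: esum_ge0 => c _; rewrite lee_fin expR_ge0.
Qed.

Lemma cover_sum_nondecreasing Z s e : nondecreasing_seq (fun N => cover_sum f Z s N e).
Proof.
move=> m n mn; apply: ereal_inf_le_tmp => _ [G [Gn GZ] <-].
by exists G => //; split => // c /Gn; exact: leq_trans.
Qed.

Lemma cover_lim_eq0 Z s e :
  cover_lim f Z s e = 0%E <-> forall N, cover_sum f Z s N e = 0%E.
Proof.
have cv := ereal_nondecreasing_cvgn (@cover_sum_nondecreasing Z s e).
rewrite /cover_lim (cvg_lim _ cv)//; split => [E N|E].
  apply/eqP; rewrite eq_le cover_sum_ge0 andbT -E.
  by apply: ereal_sup_ubound; exists N.
suff -> : range (fun N => cover_sum f Z s N e) = [set 0%E] by rewrite ereal_sup1.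
by apply/seteqP; split => [_ [N _ <-]|_ ->]; [exact: E|exists 0%N].
Qed.

(** The bound at the exponent [s] extends to smaller exponents, for which the
    weights are larger. *)
Lemma entropy_ge Z e s N :
  (forall G, dyn_cover f Z N e G -> 1 <= \esum_(c in G) (weight s c)%:E)%E ->
  (s%:E <= entropy_at f Z e)%E.
Proof.
move=> H; apply: le_ereal_inf_tmp => _ [s' /cover_lim_eq0 s'0 <-].
rewrite lee_fin leNgt; apply/negP => s's.
suff : (1 <= cover_sum f Z s' N e)%E by rewrite s'0 lee_fin ler10.
apply: le_ereal_inf_tmp => _ [G /H GZ <-]; apply: le_trans GZ _.
apply: le_esum => c _; rewrite lee_fin ler_expR ler_wpM2r ?ler0n//.
by rewrite lerN2 ltW.
Qed.

Lemma entropy_le Z e s :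
  (forall N r, 0 < r -> exists2 G, dyn_cover f Z N e G &
     (\esum_(c in G) (weight s c)%:E <= r%:E)%E) ->
  (entropy_at f Z e <= s%:E)%E.
Proof.
move=> H; apply: ereal_inf_lbound; exists s => //; apply/cover_lim_eq0 => N.
apply/eqP; rewrite eq_le cover_sum_ge0 andbT.
apply/lee_addgt0Pr => r r0; rewrite add0e.
have [G GZ Gr] := H N r r0; apply: le_trans Gr.
by apply: ereal_inf_lbound; exists G.
Qed.

Lemma entropy_ge0 Z e : Z !=set0 -> (0 <= entropy_at f Z e)%E.
Proof.
move=> [x Zx]; apply: (@entropy_ge _ _ _ 0%N) => G [_ /(_ _ Zx)[c Gc _]].
rewrite -[leLHS](_ : (weight 0 c)%:E = _); last by rewrite /weight oppr0 mul0r expR0.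
rewrite -(@esum_set1 _ _ c (fun c => (weight 0 c)%:E)) ?lee_fin ?expR_ge0//.
apply: esum_ge; exists [set c]; last by rewrite esum_set1 ?fsbig_set1 ?lee_fin ?expR_ge0.
by split => // ? ->.
Qed.

End entropy.

(** * Counting separated points with good averages *)

Section geometric.
Variable R : realType.

Lemma esum_geometric_tail (rho : R) (N : nat) (K : set nat) : 0 <= rho < 1 ->
  (forall n, K n -> (N <= n)%N) ->
  (\esum_(n in K) (rho ^+ n)%:E <= (rho ^+ N / (1 - rho))%:E)%E.
Proof.
move=> /andP[rho0 rho1] KN; have r1 : 0 < 1 - rho by rewrite subr_gt0.
apply: (@le_trans _ _ (\esum_(n in [set n | (N <= n)%N]) (rho ^+ n)%:E)%E).
  rewrite (_ : K = [set n | (N <= n)%N] `&` K); last by rewrite setIidr.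
  rewrite esum_mkcondr; apply: le_esum => n _.
  by case: ifP => // _; rewrite lee_fin exprn_ge0.
rewrite -nneseries_esum => [|n _]; last by rewrite lee_fin exprn_ge0.
apply: lime_le; first by apply: is_cvg_nneseries => n _ _; rewrite lee_fin exprn_ge0.
apply: nearW => n; rewrite sumEFin lee_fin ler_pdivlMr//.
have -> : (\sum_(0 <= i < n | (N <= i)%N) rho ^+ i) * (1 - rho) =
          if (N <= n)%N then rho ^+ N - rho ^+ n else 0.
  elim: n => [|n ih].
    by rewrite big_geq// mul0r; case: N {KN} => //=; rewrite subrr.
  rewrite big_mkcond big_nat_recr//= -big_mkcond mulrDl ih.
  have [Nn|nN] := leqP N n; first by rewrite (leqW Nn) exprS; lra.
  rewrite mul0r addr0; case: ifP => // Nn; suff -> : N = n.+1 by rewrite subrr.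
  by apply/eqP; rewrite eqn_leq nN Nn.
by case: ifP => _; [rewrite gerBl exprn_ge0|rewrite exprn_ge0].
Qed.

Lemma small_geometric (eta r : R) : 0 < eta -> 0 < r ->
  exists N, forall n, (N <= n)%N -> expR (- eta) ^+ n <= r.
Proof.
move=> eta0 r0; exists (Num.trunc (r^-1 / eta)).+1 => n Nn.
rewrite -expRM_natr mulNr expRN -[leRHS]invrK lef_pV2 ?posrE ?invr_gt0 ?expR_gt0//.
apply: le_trans (expR_ge1Dx _); rewrite -[leLHS]add0r lerD// mulrC -ler_pdivrMr//.
by rewrite (le_trans (ltW (truncnS_gt _)))// ler_nat.
Qed.

End geometric.

Section rich.
Variables (R : realType) (X : metricType R) (f : X -> X) (phi : X -> R).

Definition birkhoff n x : R := \sum_(0 <= j < n) phi (iter j f x).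

(** The counting is required at all large times, and not only at infinitely many,
    so that words for several values or stages exist with prescribed lengths. *)
Definition rich (a s e : R) := forall d, 0 < d -> exists n0, forall n, (n0 <= n)%N ->
  exists E, [/\ separated f n e E,
    {in E, forall x, `|birkhoff n x - n%:R * a| <= d * n%:R} &
    expR (s * n%:R) <= (size E)%:R].

Lemma level_setP a x : level_set f phi a x <->
  forall d, 0 < d -> exists m, forall n, (m <= n)%N ->
    `|birkhoff n x - n%:R * a| <= d * n%:R.
Proof.
have eqn n d : (0 < n)%N ->
    (`|a - n%:R^-1 * birkhoff n x| <= d) = (`|birkhoff n x - n%:R * a| <= d * n%:R).
  move=> n0; have nR : 0 < n%:R :> R by rewrite ltr0n.
  rewrite -(ler_pM2r nR) -{2}(gtr0_norm nR) -normrM distrC mulrBl.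
  by rewrite mulrAC mulVf ?gt_eqF// mul1r (mulrC a).
split => [/cvgrPdist_le H d d0|H].
  have [m _ mP] := H d d0; exists m => -[_|n mn].
    by rewrite /birkhoff big_geq// !mul0r mulr0 subrr normr0.
  by rewrite -eqn//; exact: mP.
apply/cvgrPdist_le => d d0; have [m mP] := H d d0.
by exists m.+1 => // n /= mn; rewrite eqn ?(leq_trans _ mn)//; apply/mP/ltnW.
Qed.

Lemma rich_of_nonempty a e : level_set f phi a !=set0 -> rich a 0 e.
Proof.
move=> [x /level_setP xa] d /xa[m mP]; exists m => n /mP nP.
exists [:: x]; split; last by rewrite mul0r expR0.
  by split => // y z; rewrite !inE => /eqP -> /eqP ->; rewrite eqxx.
by move=> y; rewrite inE => /eqP ->.
Qed.

(** If the growth fails at infinitely many times [n], maximal separated sets at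
    these bad times cover the level set, each of its points having good
    averages from some time on. With the exponent [s + eta], a bad time [n]
    contributes at most [expR (- eta) ^+ n], and such tails are arbitrarily
    small. *)
Lemma rich_of_entropy a s e : 0 < e ->
  (s%:E < entropy_at f (level_set f phi a) e)%E -> rich a s e.
Proof.
move=> e0; rewrite ltNge => /negP hs d d0; apply: contrapT => /forallNP poor.
apply: hs; apply/lee_addgt0Pr => eta eta0.
pose P n : set X := [set x | `|birkhoff n x - n%:R * a| <= d * n%:R].
pose bad n := forall E, separated f n e E -> [set` E] `<=` P n ->
  (size E)%:R <= expR (s * n%:R).
have badP n0 : exists2 n, (n0 <= n)%N & bad n.
  have /existsNP[n /not_implyP[n0n nE]] := poor n0; exists n => // E sE EP.
  by rewrite leNgt; apply/negP => Es; apply: nE; exists E; split => //; exact: ltW.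
have /choice[E EP] n : exists E, bad n -> [/\ separated f n e E, [set` E] `<=` P n &
    forall x, P n x -> exists2 y, y \in E & dyn_dist f n y x < e].
  have [bn|nbn] := pselect (bad n); last by exists [::].
  by have [E ?] := maximal_separated e0 bn; exists E.
rewrite -EFinD; apply: entropy_le => N r r0.
pose rho := expR (- eta).
have rho1 : 0 <= rho < 1 by rewrite expR_ge0 -expR0 ltr_expR oppr_lt0.
have [N1 N1P] : exists N, forall n, (N <= n)%N -> rho ^+ n <= r * (1 - rho).
  by apply: small_geometric => //; rewrite mulr_gt0// subr_gt0; case/andP: rho1.
pose N' := maxn N N1.
pose K := [set n | (N' <= n)%N /\ bad n].
pose J n : set (X * nat) := [set c | c.2 = n /\ c.1 \in E n].
exists (\bigcup_(n in K) J n).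
  split; first by move=> c [n [N'n _] [-> _]]; apply: leq_trans N'n; exact: leq_maxl.
  move=> x /level_setP/(_ d d0)[m mP].
  have [n] := badP (maxn m N'); rewrite geq_max => /andP[mn N'n] bn.
  have [_ _ /(_ x (mP n mn))[y yE yx]] := EP n bn.
  by exists (y, n) => //; exists n.
rewrite esum_bigcupT; first last.
- by move=> c; rewrite lee_fin expR_ge0.
- by move=> i j _ _ [c [[<- _] [<- _]]].
apply: (@le_trans _ _ (\esum_(n in K) (rho ^+ n)%:E)%E); last first.
  apply: le_trans (esum_geometric_tail rho1 (N := N') _) _; first by move=> n [].
  rewrite lee_fin ler_pdivrMr ?N1P ?leq_maxr//.
  by rewrite subr_gt0; case/andP: rho1.
apply: le_esum => n [_ bn]; have [sE EPn _] := EP n bn.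
have JE : J n = [set (x, n) | x in [set` E n]].
  apply/seteqP; split => [[x k] [/= -> xE]|_ [x xE <-]]; first by exists x.
  by split.
rewrite JE esum_image; last by move=> x y _ _ [].
rewrite esum_fset; last 2 first.
- exact: finite_seq.
- by move=> x _; rewrite lee_fin expR_ge0.
rewrite -fsbig_seq; last by case: sE.
rewrite sumEFin lee_fin (eq_bigr (fun=> expR (- (s + eta) * n%:R)))//.
rewrite big_const_seq count_predT iter_addr_0 -[leLHS]mulr_natr mulrC.
apply: (@le_trans _ _ (expR (s * n%:R) * expR (- (s + eta) * n%:R))).
  by rewrite ler_wpM2r ?expR_ge0 ?bn.
by rewrite -expRD -expRM_natr ler_expR; lra.
Qed.

End rich.

(** * Following orbits, and concavity of richness *)

Lemma eventually_le_linear (R : realType) (c d : R) : 0 < d ->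
  exists n0, forall n, (n0 <= n)%N -> c <= d * n%:R.
Proof.
move=> d0; exists (Num.trunc (c / d)).+1 => n n0n.
rewrite mulrC -ler_pdivrMr// (le_trans (ltW (truncnS_gt _)))// ler_nat//.
Qed.

Lemma split_time (R : realType) (t : R) (m k : nat) : 0 < t < 1 ->
  exists n0, forall n, (n0 <= n)%N -> exists n1 n2,
    [/\ n = (n1 + m + n2)%N, (k <= n1)%N, (k <= n2)%N,
     `|n1%:R - t * n%:R| <= 1 & `|n2%:R - (1 - t) * n%:R| <= m.+1%:R].
Proof.
move=> /andP[t0 t1]; have t1' : 0 < 1 - t by rewrite subr_gt0.
have [p pP] := eventually_le_linear k.+1%:R t0.
have [q qP] := eventually_le_linear (k + m)%:R t1'.
exists (maxn p q) => n; rewrite geq_max => /andP[/pP pn /qP qn].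
have tn0 : 0 <= t * n%:R by rewrite mulr_ge0// ltW.
have := truncn_itv tn0; move: (Num.trunc _) => n1 /andP[l1 l2].
have H : (k + m + n1 <= n)%N.
  rewrite -(ler_nat R) natrD; move: qn; lra.
exists n1, (n - n1 - m)%N; split.
- lia.
- by rewrite -ltnS -(ltr_nat R); apply: le_lt_trans l2; rewrite (le_trans _ pn)// ler_nat.
- lia.
- rewrite -addn1 natrD in l2; clear -l1 l2; rewrite ler_norml; apply/andP; split; lra.
- rewrite -addn1 natrD in l2; rewrite -(addn1 m) natrD.
  rewrite !natrB ?natrD; [|lia|lia].
  have m0 : 0 <= m%:R :> R by [].
  clear -l1 l2 m0.
  rewrite ler_norml; apply/andP; split; lra.
Qed.

Section trace.
Variables (R : realType) (X : metricType R) (f : X -> X) (phi : X -> R).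

Definition traces (c : R) (a n : nat) (y x : X) :=
  forall p, (p < n)%N -> mdist (iter (p + a) f y) (iter p f x) <= c.

(** Orbits that follow distinct separated words with precision [e / 4] remain
    [e / 2] apart; this is how a cover by balls of radius [e / 4] recognizes the
    words. *)
Lemma traces_separate e c a n N y y' x x' : 0 < e -> c <= e / 4 -> (a + n <= N)%N ->
  traces c a n y x -> traces c a n y' x' -> dyn_dist f N y y' < e / 2 ->
  dyn_dist f n x x' < e.
Proof.
move=> e0 ce anN yx yx'; have e20 : 0 < e / 2 by rewrite divr_gt0.
move=> /(dyn_dist_ltP _ _ _ _ e20) yy'; apply/(dyn_dist_ltP _ _ _ _ e0) => p pn.
have h1 := yx p pn; have h2 := yx' p pn.
have h3 := yy' (p + a)%N ltac:(lia).
have := metric_triangle (iter p f x) (iter (p + a) f y) (iter p f x').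
have := metric_triangle (iter (p + a) f y) (iter (p + a) f y') (iter p f x').
rewrite (metric_sym (iter p f x) (iter (p + a) f y)); lra.
Qed.

Lemma birkhoffD n m x : birkhoff f phi (n + m) x =
  birkhoff f phi n x + birkhoff f phi m (iter n f x).
Proof.
rewrite /birkhoff (@big_cat_nat _ _ _ n)//= ?leq_addr//; congr (_ + _).
rewrite -{1}[n]add0n big_addn addKn; apply: eq_bigr => i _.
by rewrite iterD.
Qed.

Lemma birkhoff_bounded M n x : (forall x, `|phi x| <= M) ->
  `|birkhoff f phi n x| <= M * n%:R.
Proof.
move=> bM; apply: le_trans (ler_norm_sum _ _ _) _.
apply: (@le_trans _ _ (\sum_(0 <= i < n) M)); first exact: ler_sum.
by rewrite sumr_const_nat subn0 mulr_natr.
Qed.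

Lemma birkhoff_traces del d c a n y x :
  (forall x y, mdist x y < del -> `|phi x - phi y| < d) ->
  c < del -> traces c a n y x ->
  `|birkhoff f phi n (iter a f y) - birkhoff f phi n x| <= d * n%:R.
Proof.
move=> unif cdel yx; rewrite /birkhoff -sumrB.
apply: le_trans (ler_norm_sum _ _ _) _.
apply: (@le_trans _ _ (\sum_(0 <= i < n) d)); last first.
  by rewrite sumr_const_nat subn0 mulr_natr.
rewrite !big_mkord; apply: ler_sum => i _; apply/ltW/unif.
by rewrite -iterD; apply: le_lt_trans cdel; exact: yx.
Qed.

Hypothesis cX : compact [set: X].
Hypothesis cphi : continuous phi.
Hypothesis specf : specification f.

Lemma spec_pair c : 0 < c -> exists m, forall n1 n2 u v, (0 < n1)%N -> (0 < n2)%N ->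
  exists y, traces c 0 n1 y u /\ traces c (n1 + m) n2 y v.
Proof.
move=> c0; have [m mP] := specf c0; exists m => n1 n2 u v n10 n20.
have [||y yP] := mP 2%N (fun j => if j == 0%N then 0%N else (n1 + m)%N)
  (fun j => if j == 0%N then n1.-1 else (n1 + m + n2.-1)%N)
  (fun j => if j == 0%N then u else v) isT.
- by case=> [|j] _ //=; rewrite leq_addr.
- by case=> [|j] //= _; rewrite leq_add2r leq_pred.
exists y; split => p pn; apply/ltW.
  by have := yP 0%N p isT; apply; rewrite /=; lia.
by have := yP 1%N p isT; apply; rewrite /=; lia.
Qed.

(** The new points follow a word for [a1] during about [t * n] steps, then, after
    a gap of bounded length [m], a word for [a2]. The gap and the rounding change
    Birkhoff sums and exponents by bounded amounts, absorbed for large [n] by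
    [d / 2] and by the slack in [s]. *)
Lemma rich_convex a1 a2 s1 s2 s e t : 0 < e -> 0 < t < 1 ->
  s < t * s1 + (1 - t) * s2 ->
  rich f phi a1 s1 e -> rich f phi a2 s2 e ->
  rich f phi (t * a1 + (1 - t) * a2) s (e / 2).
Proof.
move=> e0 t01 ss r1 r2 d d0.
have d40 : 0 < d / 4 by rewrite divr_gt0.
have d20 : 0 < d / 2 by rewrite divr_gt0.
have [M M0 bM] := compact_fun_bounded cX cphi.
have [del del0 unif] := compact_unif_cont cX cphi d40.
pose c := Num.min (e / 4) (del / 2).
have c0 : 0 < c by rewrite lt_min !divr_gt0.
have ce : c <= e / 4 by rewrite ge_min lexx.
have cdel : c < del by rewrite gt_min; apply/orP; right; lra.
have [m mP] := spec_pair c0.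
have [k1 k1P] := r1 _ d40; have [k2 k2P] := r2 _ d40.
have [N NP] := split_time m (maxn 1 (maxn k1 k2)) t01.
have [N1 N1P] := eventually_le_linear (M * m%:R + `|a1| + m.+1%:R * `|a2|) d20.
have gap : 0 < t * s1 + (1 - t) * s2 - s by rewrite subr_gt0.
have [N2 N2P] := eventually_le_linear (`|s1| + m.+1%:R * `|s2|) gap.
exists (maxn N (maxn N1 N2)) => n; rewrite !geq_max => /and3P[/NP nP /N1P n1P /N2P n2P].
have [n1 [n2 []]] := nP; rewrite !geq_max.
move=> nE /and3P[n10 k1n _] /and3P[n20 _ k2n] t1 t2.
have [E1 [sE1 bE1 cE1]] := k1P _ k1n; have [E2 [sE2 bE2 cE2]] := k2P _ k2n.
have /choice[y yP] (uv : X * X) := mP n1 n2 uv.1 uv.2 n10 n20.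
have inj u v u' v' : u \in E1 -> u' \in E1 -> v \in E2 -> v' \in E2 ->
    dyn_dist f n (y (u, v)) (y (u', v')) < e / 2 -> u = u' /\ v = v'.
  move=> uE u'E vE v'E yy; have [yu yv] := yP (u, v); have [yu' yv'] := yP (u', v').
  split; apply/eqP; apply: contrapT => /negP uu.
    have := sE1.2 u u' uE u'E uu; rewrite leNgt => /negP; apply.
    by apply: (traces_separate e0 ce _ yu yu' yy); rewrite nE add0n -addnA leq_addr.
  have := sE2.2 v v' vE v'E uu; rewrite leNgt => /negP; apply.
  by apply: (traces_separate e0 ce _ yv yv' yy); rewrite nE.
have norm_mul (z w r : R) : `|z| <= r -> `|z * w| <= r * `|w|.
  by move=> h; rewrite normrM ler_wpM2r.
have norm_add (z w r q : R) : `|z| <= r -> `|w| <= q -> `|z + w| <= r + q.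
  by move=> zr wq; apply: le_trans (ler_normD _ _) (lerD zr wq).
exists [seq y (u, v) | u <- E1, v <- E2]; split.
- split.
    apply: allpairs_uniq; [exact: sE1.1|exact: sE2.1|].
    move=> [u v] [u' v'] /allpairsP[[u1 v1] [/= uE vE [-> ->]]].
    move=> /allpairsP[[u1' v1'] [/= u'E v'E [-> ->]]] yy.
    have [|-> ->//] := inj u1 v1 u1' v1' uE u'E vE v'E.
    rewrite yy; apply/dyn_dist_ltP => [|i _]; first by rewrite divr_gt0.
    by rewrite mdistxx divr_gt0.
  move=> x x' /allpairsP[[u v] [/= uE vE ->]] /allpairsP[[u' v'] [/= u'E v'E ->]].
  apply: contraNT; rewrite -ltNge => yy.
  by have [-> ->] := inj _ _ _ _ uE u'E vE v'E yy.
- move=> x /allpairsP[[u v] [/= uE vE ->]]; have [/= yu yv] := yP (u, v).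
  have := birkhoff_traces unif cdel yu; have := birkhoff_traces unif cdel yv.
  have := bE1 u uE; have := bE2 v vE.
  have := @birkhoff_bounded M m (iter n1 f (y (u, v))) bM.
  have := norm_mul _ a1 _ t1; have := norm_mul _ a2 _ t2; rewrite mul1r.
  have nR : n%:R = n1%:R + m%:R + n2%:R :> R by rewrite nE !natrD.
  have md : 0 <= d * m%:R by rewrite mulr_ge0// ltW.
  rewrite [in birkhoff f phi n _]nE !birkhoffD /=.
  move: (birkhoff f phi n1 (y (u, v))) (birkhoff f phi m _)
    (birkhoff f phi n2 (iter _ f _)) (birkhoff f phi n1 u) (birkhoff f phi n2 v).
  move=> b1 b2 b3 b4 b5 e1 e2 e3 e4 e5 e6 e7.
  rewrite (_ : _ - _ = (b1 - b4) + (b4 - n1%:R * a1) + b2 + (b3 - b5) +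
    (b5 - n2%:R * a2) + (n1%:R - t * n%:R) * a1 + (n2%:R - (1 - t) * n%:R) * a2); last by ring.
  apply: le_trans (norm_add _ _ _ _ (norm_add _ _ _ _ (norm_add _ _ _ _
    (norm_add _ _ _ _ (norm_add _ _ _ _ (norm_add _ _ _ _ e7 e5) e3) e6) e4) e2) e1) _.
  clear -md nR n1P.
  rewrite nR in n1P *; lra.
- rewrite size_allpairs natrM; apply: le_trans (ler_pM _ _ cE1 cE2); rewrite ?expR_ge0//.
  rewrite -expRD ler_expR.
  have := norm_mul _ s1 _ t1; have := norm_mul _ s2 _ t2; rewrite mul1r.
  rewrite !ler_norml; move: n2P => h /andP[h1 h2] /andP[h3 h4]; lra.
Qed.

End trace.

(** * An orbit following infinitely many words *)

(** Specification at a single precision, because the construction fixes one gap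
    per stage. *)
Definition gap_spec (R : realType) (X : metricType R) (f : X -> X) (g : nat)
    (e : R) : Prop :=
  forall (r : nat) (a b : nat -> nat) (x : nat -> X),
    (0 < r)%N ->
    (forall j, (j < r)%N -> (a j <= b j)%N) ->
    (forall j, (j.+1 < r)%N -> (b j + g <= a j.+1)%N) ->
    exists y : X, forall j p, (j < r)%N -> (p <= b j - a j)%N ->
      mdist (iter (p + a j) f y) (iter p f (x j)) < e.

Section blocks.
Variables (gap len kap : nat -> nat).
Hypothesis len_gt0 : forall k, (0 < len k)%N.
Hypothesis kap_homo : {homo kap : i j / (i <= j)%N}.
Hypothesis kap_unbounded : forall K, exists J, forall j, (J <= j)%N -> (K <= kap j)%N.

Definition block k := (gap k + len k)%N.

(** Block [j] occupies the times from [start j] to [start j.+1]: first the gap of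
    its stage [kap j], then its word. Placing the gap in front makes the first
    gap of a new stage as long as the precision of that stage requires. *)
Definition start j := (\sum_(i < j) block (kap i))%N.

Lemma block_gt0 k : (0 < block k)%N.
Proof. by rewrite addn_gt0 len_gt0 orbT. Qed.

Lemma startS j : start j.+1 = (start j + gap (kap j) + len (kap j))%N.
Proof. by rewrite /start big_ord_recr/= addnA. Qed.

Lemma start_homo : {homo start : i j / (i <= j)%N}.
Proof. by apply: homo_leq => [//|? ? ?|j]; [exact: leq_trans|rewrite startS; lia]. Qed.

Lemma leq_start j : (j <= start j)%N.
Proof. by elim: j => // j ih; rewrite startS; have := len_gt0 (kap j); lia. Qed.

Lemma block_index n : exists j, [/\ (start j <= n)%N, (n < start j.+1)%N &
  forall J, (start J <= n)%N -> (J <= j)%N].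
Proof.
have ex : exists j, (start j <= n)%N by exists 0%N; rewrite /start big_ord0.
have bnd j : (start j <= n)%N -> (j <= n)%N by apply: leq_trans; exact: leq_start.
have [j jn jmax] := ex_maxnP ex bnd; exists j; split => //.
by rewrite ltnNge; apply/negP => /jmax; rewrite ltnn.
Qed.

Lemma stage_start : exists T : nat -> nat, forall k j, (T k <= j)%N = (k <= kap j)%N.
Proof.
have ex k : exists j, (k <= kap j)%N by have [J /(_ J (leqnn J))] := kap_unbounded k; exists J.
exists (fun k => ex_minn (ex k)) => k j; case: ex_minnP => m km mmin.
by apply/idP/idP => [/kap_homo|/mmin//]; exact: leq_trans.
Qed.

Section infinite_trace.
Variables (R : realType) (X : metricType R) (f : X -> X).
Hypothesis cX : compact [set: X].
Hypothesis cf : continuous f.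

Lemma cluster_traces (Y : nat -> X) y c a n x L : cluster (Y @ \oo) y ->
  (forall l, (L <= l)%N -> traces f c a n (Y l) x) -> traces f c a n y x.
Proof.
move=> cy YL p pn; rewrite leNgt; apply/negP => far.
pose D := mdist (iter (p + a) f y) (iter p f x) - c.
have D0 : 0 < D by rewrite subr_gt0.
have nb : nbhs y [set z | mdist (iter (p + a) f y) (iter (p + a) f z) < D].
  have /metricType_numDomainType.cvgrPdist_lt := iter_continuous (n := (p + a)%N) cf (x := y).
  exact.
have ev : (Y @ \oo) [set z | mdist (iter (p + a) f z) (iter p f x) <= c].
  by exists L => // l /= /YL; exact.
have [z [/= zx yz]] := cy _ _ ev nb.
have := metric_triangle (iter (p + a) f y) (iter (p + a) f z) (iter p f x).
by rewrite /D in yz; lra.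
Qed.

Variable c : R.
Hypothesis c_gt0 : 0 < c.

(** Stage [k] is followed with precision [prec k.+1] when it is added, and the
    later stages perturb it by [prec k.+2 + prec k.+3 + ...], whence the final
    precision [prec k]. *)
Definition prec k : R := c / 2 ^+ k.

Lemma prec_gt0 k : 0 < prec k.
Proof. by rewrite divr_gt0// exprn_gt0. Qed.

Lemma precS k : prec k = prec k.+1 *+ 2.
Proof. by rewrite /prec exprSr invfM mulrA [RHS]mulr2n -splitr. Qed.

Hypothesis gapP : forall k, gap_spec f (gap k) (prec k.+1).

(** One use of specification with precision [prec k.+1]: the first interval is the
    orbit constructed so far, the others are the words of stage [k]. Redoing the
    whole past in one interval is what allows the precision to improve. *)
Lemma extend_stage (T : nat -> nat) (x : nat -> X) k y :
  (forall k j, (T k <= j)%N = (k <= kap j)%N) ->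
  exists y', traces f (prec k.+1) 0 (start (T k)) y' y /\
    forall j, kap j = k -> traces f (prec k.+1) (start j + gap k) (len k) y' (x j).
Proof.
move=> TP.
have kapE i : (T k + i < T k.+1)%N -> kap (T k + i) = k.
  rewrite ltnNge TP -ltnNge ltnS => h; apply/eqP; rewrite eqn_leq h.
  by rewrite -TP leq_addr.
pose a i := if i is i'.+1 then (start (T k + i') + gap k)%N else 0%N.
pose b i := if i is i'.+1 then (start (T k + i') + gap k + (len k).-1)%N
            else (start (T k)).-1.
pose z i := if i is i'.+1 then x (T k + i')%N else y.
have [//||| y' y'P] := gapP (k := k) (r := (T k.+1 - T k).+1) (a := a) (b := b) z.
- by case=> [|i] _ //=; rewrite leq_addr.
- case=> [|i] /=; first by rewrite addn0; lia.
  move=> h; have lk := len_gt0 k; rewrite addnS startS kapE; lia.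
exists y'; split => [p pT|j jk p pn]; apply/ltW.
  by have := y'P 0%N p isT; apply => /=; lia.
have Tj : (T k <= j)%N by rewrite TP jk.
have jT : (j < T k.+1)%N by rewrite ltnNge TP jk ltnn.
have := y'P (j - T k).+1 p; rewrite /= subnKC//; apply; lia.
Qed.

(** The orbits that follow finitely many stages accumulate, and each following
    condition is closed. *)
Lemma infinite_trace (x : nat -> X) : exists y, forall j,
  traces f (prec (kap j)) (start j + gap (kap j)) (len (kap j)) y (x j).
Proof.
have [T TP] := stage_start.
have /choice[ext extP] (ky : nat * X) := @extend_stage T x ky.1 ky.2 TP.
pose Y := fix Y k := if k is k'.+1 then ext (k', Y k') else x 0%N.
have := cX (F := Y @ \oo) _ filterT; case=> y [_ cy]; exists y => j.
apply: (cluster_traces cy (L := (kap j).+1)) => l /subnKC <-.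
set d := (l - _)%N.
(* the errors of the successive stages form a geometric series *)
suff H : traces f (prec (kap j) - prec (kap j + d.+1)) (start j + gap (kap j))
    (len (kap j)) (Y (kap j + d.+1)%N) (x j).
  by move=> p /H; rewrite addSnnS => /le_trans; apply; rewrite lerBlDr lerDl ltW// prec_gt0.
elim: d => [|d ih] p pn.
  rewrite addn1 precS mulr2n addrK /=.
  exact: (extP (kap j, Y (kap j))).2.
have h1 := ih p pn; rewrite addnS /=.
set q := (p + _)%N in h1 *.
have h2 : mdist (iter q f (ext ((kap j + d.+1)%N, Y (kap j + d.+1)%N)))
    (iter q f (Y (kap j + d.+1)%N)) <= prec (kap j + d.+1).+1.
  have := (extP ((kap j + d.+1)%N, Y (kap j + d.+1)%N)).1 q; rewrite addn0; apply.
  have jT : (j < T (kap j + d.+1)%N)%N by rewrite ltnNge TP; lia.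
  by apply: leq_trans (start_homo jT); rewrite startS /q; lia.
apply: le_trans (metric_triangle _ (iter q f (Y (kap j + d.+1)%N)) _) _.
have := precS (kap j + d.+1); rewrite mulr2n; lra.
Qed.

End infinite_trace.

Section average.
Variables (R : realType) (X : metricType R) (f : X -> X) (phi : X -> R).
Hypothesis cX : compact [set: X].
Hypothesis cphi : continuous phi.
Hypothesis gap_len : forall k, (k * gap k <= len k)%N.
Hypothesis kap_slow : forall j, (kap j * block (kap j) <= start j)%N.

(** The error on a block of stage [k] is small relative to the block: its gap is at
    most [len k / k], its word has average close to [al], and following it with
    precision [prec c k] costs little by uniform continuity. The incomplete block
    at the end is negligible by [kap_slow]. *)
Lemma traced_average (c al : R) (x : nat -> X) y : 0 < c ->
  (forall j, `|birkhoff f phi (len (kap j)) (x j) - (len (kap j))%:R * al| <=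
     (kap j).+1%:R^-1 * (len (kap j))%:R) ->
  (forall j, traces f (prec c (kap j)) (start j + gap (kap j)) (len (kap j)) y (x j)) ->
  level_set f phi al y.
Proof.
move=> c0 xP yx; apply/level_setP => d d0.
have [M M0 bM] := compact_fun_bounded cX cphi.
have C0 : 0 < M + `|al| by rewrite ltr_wpDr.
pose u j := `|birkhoff f phi (block (kap j)) (iter (start j) f y) -
              (block (kap j))%:R * al|.
have d20 : 0 < d / 2 by rewrite divr_gt0.
have bnd n z : `|birkhoff f phi n z - n%:R * al| <= (M + `|al|) * n%:R.
  apply: le_trans (ler_normB _ _) _; rewrite mulrDl lerD ?birkhoff_bounded//.
  by rewrite normrM normr_nat mulrC.
have split_err n m z : `|birkhoff f phi (n + m) z - (n + m)%:R * al| <=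
    `|birkhoff f phi n z - n%:R * al| +
    `|birkhoff f phi m (iter n f z) - m%:R * al|.
  by rewrite birkhoffD natrD mulrDl opprD addrACA ler_normD.
have [J JP] : exists J, forall j, (J <= j)%N ->
    \sum_(i < j) u i <= d / 2 * (start j)%:R.
  apply: (weighted_cesaro (b := fun i => block (kap i)) (u := u)) => //.
    by move=> i; exact: block_gt0.
  move=> e e0; have e30 : 0 < e / 3 by rewrite divr_gt0.
  have [del del0 unif] := compact_unif_cont cX cphi e30.
  have [K1 K1P] := eventually_le_linear (M + `|al|) e30.
  have [K2 K2P] := eventually_le_linear 1 e30.
  have [K3 K3P] := eventually_le_linear (c + 1) del0.
  have [J JP] := kap_unbounded (maxn K1 (maxn K2 K3)).
  exists J => i /JP; rewrite !geq_max => /and3P[/K1P k1 /K2P k2 /K3P k3].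
  rewrite /u; apply: le_trans (split_err _ _ _) _; rewrite -iterD.
  set k := kap i in k1 k2 k3 *.
  have cdel : prec c k < del.
    rewrite ltr_pdivrMr ?exprn_gt0//; apply: (@lt_le_trans _ _ (del * k%:R)); first lra.
    by rewrite ler_pM2l// -natrX ler_nat ltnW// ltn_expl.
  have := birkhoff_traces unif cdel (yx i); rewrite -/k addnC => h1.
  have h2 := xP i; rewrite -/k in h2.
  have h3 := bnd (gap k) (iter (start i) f y).
  have h4 : (M + `|al|) * (gap k)%:R <= e / 3 * (len k)%:R.
    apply: (@le_trans _ _ (e / 3 * k%:R * (gap k)%:R)); first by rewrite ler_wpM2r.
    by rewrite -mulrA ler_pM2l// -natrM ler_nat gap_len.
  have h5 : k.+1%:R^-1 * (len k)%:R <= e / 3 * (len k)%:R.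
    rewrite ler_wpM2r// -[leLHS]mul1r ler_pdivrMr// (le_trans k2)// ler_pM2l// ler_nat//.
  have h6 : e / 3 * 3 * (len k)%:R <= e * (block k)%:R.
    by rewrite divfK// ler_pM2l// ler_nat leq_addl.
  have h7 := ler_normD (birkhoff f phi (len k) (iter (gap k + start i) f y) -
      birkhoff f phi (len k) (x i)) (birkhoff f phi (len k) (x i) - (len k)%:R * al).
  rewrite addrA subrK in h7.
  apply: le_trans (lerD (le_trans h3 h4) (le_trans h7 (lerD h1 (le_trans h2 h5)))) _.
  apply: le_trans h6; rewrite (mulrAC (e / 3)); move: (e / 3 * _) => w; lra.
have [K KP] := eventually_le_linear (M + `|al|) d20.
have [J' J'P] := kap_unbounded K.
exists (start (maxn J J')) => n /[dup] Jn.
have [j [jn nj jmax]] := block_index n.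
move=> /jmax; rewrite geq_max => /andP[/JP h1 /J'P/KP h2].
have sums : `|birkhoff f phi (start j) y - (start j)%:R * al| <= \sum_(i < j) u i.
  elim: (j) => [|i ih].
    by rewrite /start !big_ord0 /birkhoff big_geq// mul0r subrr normr0.
  rewrite big_ord_recr/= /start big_ord_recr/= -/(start i).
  by apply: le_trans (split_err _ _ _) _; rewrite lerD2r.
rewrite -(subnKC jn); apply: le_trans (split_err _ _ _) _.
have h3 := bnd (n - start j)%N (iter (start j) f y).
have h4 : (M + `|al|) * (n - start j)%:R <= d / 2 * (start j)%:R.
  apply: (@le_trans _ _ (d / 2 * (kap j)%:R * (block (kap j))%:R)).
    apply: ler_pM => //; first exact: ltW.
    by rewrite ler_nat; rewrite leq_subLR; move: nj; rewrite startS -addnA; exact: ltnW.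
  by rewrite -mulrA ler_pM2l// -natrM ler_nat kap_slow.
have h5 : 0 <= d * (n - start j)%:R by rewrite mulr_ge0// ltW.
rewrite natrD; lra.
Qed.

End average.
End blocks.

(** * The entropy of the level set of a rich value *)

(** The words completed before block [j] account for almost all of the time up to
    the end of block [j], so their rate [s] leaves any [s' < s] at that later
    time. *)
Lemma word_growth (R : realType) (gap len kap : nat -> nat) (s s' : R) :
  (forall k, (0 < len k)%N) ->
  (forall K, exists J, forall j, (J <= j)%N -> (K <= kap j)%N) ->
  (forall k, (k * gap k <= len k)%N) ->
  (forall j, (kap j * block gap len (kap j) <= start gap len kap j)%N) ->
  0 < s' < s -> exists J, forall j, (J <= j)%N ->
    s' * (start gap len kap j.+1)%:R <= s * (\sum_(i < j) len (kap i))%:R.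
Proof.
move=> len0 kapu gap_len slow /andP[s'0 ss'].
have ssp : 0 < s + s' by lra.
pose d := (s - s') / (s + s'); have d0 : 0 < d by rewrite divr_gt0// subr_gt0.
have [J JP] : exists J, forall j, (J <= j)%N ->
    \sum_(i < j) (gap (kap i))%:R <= d * (start gap len kap j)%:R.
  apply: (weighted_cesaro (b := fun i => block gap len (kap i))
    (u := fun i => (gap (kap i))%:R)) => //.
    by move=> i; exact: block_gt0.
  move=> e e0; have [K KP] := eventually_le_linear 1 e0.
  have [J JP] := kapu K; exists J => i /JP/KP h.
  apply: (@le_trans _ _ (e * (kap i)%:R * (gap (kap i))%:R)); first by rewrite ler_peMl.
  rewrite -mulrA ler_pM2l// -natrM ler_nat (leq_trans (gap_len _))//.
  by rewrite leq_addl.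
have [K KP] := eventually_le_linear 1 d0.
have [J' J'P] := kapu K.
exists (maxn J J') => j; rewrite geq_max => /andP[/JP h1 /J'P/KP h2].
have h3 : (block gap len (kap j))%:R <= d * (start gap len kap j)%:R.
  apply: (@le_trans _ _ (d * (kap j)%:R * (block gap len (kap j))%:R)).
    by rewrite ler_peMl.
  by rewrite -mulrA ler_pM2l// -natrM ler_nat.
have h4 : (start gap len kap j)%:R =
    \sum_(i < j) (gap (kap i))%:R + (\sum_(i < j) len (kap i))%:R :> R.
  by rewrite -natr_sum -natrD -big_split.
have -> : start gap len kap j.+1 = (start gap len kap j + block gap len (kap j))%N.
  by rewrite /start big_ord_recr.
rewrite natrD; move: h1 h3 h4.
move: (\sum_(i < j) _) (\sum_(i < j) _)%:R (start _ _ _ _)%:R (block _ _ _)%:R.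
move=> x z w b h1 h3 h4.
have -> : z = w - x by rewrite h4 addrC addKr.
apply: (@le_trans _ _ (s' * (w + d * w))); first by rewrite ler_pM2l// lerD2l.
apply: (@le_trans _ _ (s * (w - d * w))); last first.
  by rewrite ler_pM2l ?(lt_trans s'0)// lerD2l lerN2.
have dE : d * (s + s') = s - s' by rewrite /d divfK// gt_eqF.
have -> : s' * (w + d * w) = s * (w - d * w) + (d * (s + s') - (s - s')) * w by ring.
by rewrite dE subrr mul0r addr0.
Qed.

Section moran.
Variables (R : realType) (X : metricType R) (f : X -> X) (phi : X -> R).
Hypothesis cX : compact [set: X].
Hypothesis cf : continuous f.
Hypothesis specf : specification f.
Hypothesis cphi : continuous phi.

(** The branches of the tree are the sequences of word indices [w], followed by
    the orbits of [y w]. The ball of center [z] and length [n] plays the role of a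
    cylinder of depth [idx n], the number of blocks completed at time [n]. *)
Lemma moran a s e : 0 < e -> rich f phi a s e ->
  level_set f phi a !=set0 /\ (s%:E <= entropy_at f (level_set f phi a) (e / 4))%E.
Proof.
move=> e0 rs; have e40 : 0 < e / 4 by rewrite divr_gt0.
pose c := e / 4.
have /choice[gap gapP] k : exists g, gap_spec f g (prec c k.+1).
  exact: specf (prec_gt0 e40 _).
have /choice[lenE lenEP] k : exists lE : nat * seq X, [/\ (0 < lE.1)%N, (k * gap k <= lE.1)%N,
    separated f lE.1 e lE.2,
    {in lE.2, forall x, `|birkhoff f phi lE.1 x - lE.1%:R * a| <= k.+1%:R^-1 * lE.1%:R} &
    expR (s * lE.1%:R) <= (size lE.2)%:R].
  have [|n0 n0P] := rs k.+1%:R^-1; first by rewrite invr_gt0.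
  have [|E [? ? ?]] := n0P (maxn n0 (maxn 1 (k * gap k))); first by rewrite leq_maxl.
  by exists (maxn n0 (maxn 1 (k * gap k)), E); split => //=; lia.
pose len k := (lenE k).1; pose E k := (lenE k).2.
have len0 k : (0 < len k)%N by case: (lenEP k).
have gap_len k : (k * gap k <= len k)%N by case: (lenEP k).
have sizeE k : (0 < size (E k))%N.
  case: (lenEP k) => _ _ _ _ h; rewrite -(ltr_nat R).
  exact: lt_le_trans (expR_gt0 _) h.
have [kap [kaph kapu slow]] := slow_schedule (block_gt0 gap len0).
have x0 : X by case: (E 0%N) (sizeE 0%N).
pose word (w : nat -> nat) i := nth x0 (E (kap i)) (w i).
pose valid (w : nat -> nat) := forall i, (w i < size (E (kap i)))%N.
have /choice[y yP] w : exists y, forall j,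
    traces f (prec c (kap j)) (start gap len kap j + gap (kap j)) (len (kap j)) y (word w j).
  exact: (infinite_trace len0 kaph kapu cX cf e40 gapP).
have yK w : valid w -> level_set f phi a (y w).
  move=> vw; apply: (traced_average len0 kapu cX cphi gap_len slow
    (c := c) (x := word w)) => // j.
  by case: (lenEP (kap j)) => _ _ _ + _; apply; exact: mem_nth.
have K0 : level_set f phi a !=set0.
  by exists (y (fun=> 0%N)); apply: yK => i; exact: sizeE.
split => //; apply/lee_subgt0Pr => eta eta0.
have [s'0|s'0] := leP (s - eta) 0.
  by apply: le_trans (entropy_ge0 f (e / 4) K0); rewrite -EFinB lee_fin.
have s's : s - eta < s by rewrite ltrBlDr ltrDl.
rewrite -EFinB; move: (s - eta) s'0 s's => s' s'0 s's {eta eta0}.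
have [J JP] : exists J, forall j, (J <= j)%N ->
    s' * (start gap len kap j.+1)%:R <= s * (\sum_(i < j) len (kap i))%:R.
  by apply: word_growth => //; rewrite s'0.
(* balls of length at least [start J] complete at least [J] blocks, so that the
   growth bound [JP] applies to them *)
apply: (@entropy_ge _ _ _ _ _ _ (start gap len kap J)) => G [GN GK].
have /choice[idx idxP] n := block_index gap kap len0 n.
apply: (@tree_cover _ _ (fun i => size (E (kap i))) G
  (fun c => [set w | valid w /\ dyn_ball f c.2 c.1 (e / 4) (y w)]) (fun c => idx c.2)).
- by move=> i; exact: sizeE.
- move=> [z n] Gc /=; have [_ nidx /(_ J (GN _ Gc))/JP h] := idxP n.
  apply: (@le_trans _ _ (expR (- (s * (\sum_(i < idx n) len (kap i))%:R)))); last first.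
    rewrite /weight ler_expR mulNr lerN2; apply: le_trans h.
    by rewrite ler_pM2l// ler_nat ltnW.
  rewrite natr_sum mulr_sumr -sumrN expR_sum; apply: ler_prod => i _.
  rewrite invr_ge0 ler0n /= expRN lef_pV2 ?posrE ?expR_gt0 ?ltr0n//.
  by case: (lenEP (kap i)).
- move=> [z n] w w' Gc [vw /= zw] [vw' zw'] i ij; have [idxn _ _] := idxP n.
  have [_ _ [uE sepE] _ _] := lenEP (kap i).
  apply/eqP; rewrite -(nth_uniq x0 (vw i) (vw' i) uE); apply: contraT => ww'.
  have := sepE _ _ (mem_nth x0 (vw i)) (mem_nth x0 (vw' i)) ww'.
  rewrite leNgt => /negP; case.
  have pc : prec c (kap i) <= e / 4.
    by rewrite ler_pdivrMr ?exprn_gt0// ler_peMr ?(ltW e40)// exprn_ege1// ler1n.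
  apply: (traces_separate e0 pc _ (yP w i) (yP w' i) (N := n)).
    by rewrite -startS; apply: leq_trans idxn; exact: start_homo.
  have e20 : 0 < e / 2 by rewrite divr_gt0.
  apply/(dyn_dist_ltP _ _ _ _ e20) => p pn.
  move: zw zw' => /(dyn_dist_ltP _ _ _ _ e40)/(_ p pn) h1.
  move=> /(dyn_dist_ltP _ _ _ _ e40)/(_ p pn) h2.
  apply: le_lt_trans (metric_triangle _ (iter p f z) _) _.
  by rewrite (metric_sym (iter p f (y w))); lra.
- move=> w vw; have [c0 Gc zc] := GK _ (yK w vw).
  by exists c0.
Qed.

Lemma entropy_concave a1 a2 s1 s2 e t : 0 < e -> 0 < t < 1 ->
  (s1%:E < entropy_at f (level_set f phi a1) e)%E ->
  (s2%:E < entropy_at f (level_set f phi a2) e)%E ->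
  ((t * s1 + (1 - t) * s2)%:E <=
     entropy_at f (level_set f phi (t * a1 + (1 - t) * a2)) (e / 8))%E.
Proof.
move=> e0 t01 /(rich_of_entropy e0) r1 /(rich_of_entropy e0) r2.
apply/lee_subgt0Pr => eta eta0; rewrite -EFinB.
have e20 : 0 < e / 2 by rewrite divr_gt0.
have -> : e / 8 = e / 2 / 4 by field.
apply: (moran e20 _).2; apply: (rich_convex cX cphi specf e0 t01 _ r1 r2).
by rewrite ltrBlDr ltrDl.
Qed.

Lemma level_set_convex a1 a2 t : 0 < t < 1 ->
  level_set f phi a1 !=set0 -> level_set f phi a2 !=set0 ->
  level_set f phi (t * a1 + (1 - t) * a2) !=set0.
Proof.
move=> t01 /(rich_of_nonempty 1) r1 /(rich_of_nonempty 1) r2.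
have e20 : 0 < 1 / 2 :> R by rewrite divr_gt0.
(* any negative rate leaves the slack that [rich_convex] requires *)
apply: (moran (s := -1) e20 _).1; apply: (rich_convex cX cphi specf ltr01 t01 _ r1 r2).
by rewrite !mulr0 addr0 ltrN10.
Qed.

End moran.

(** * Concavity of the lower metric mean dimension *)

Section lower_mdim.
Variables (R : realType) (X : metricType R) (f : X -> X).
Implicit Types Z : set X.

Lemma lower_mdim_ge Z (b : R) :
  (exists2 d, 0 < d < 1 & forall e, 0 < e < d -> ((b * `|ln e|)%:E <= entropy_at f Z e)%E) ->
  (b%:E <= lower_mdim f Z)%E.
Proof.
move=> [d /andP[d0 d1] H]; rewrite /lower_mdim limf_einfE.
apply: le_trans (ereal_sup_ubound _); last first.
  exists `]0, d[%classic => //; exists d => //= e /=; rewrite sub0r normrN => ed e0.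
  by rewrite in_itv /= e0 -(gtr0_norm e0).
apply: le_ereal_inf_tmp => _ [e /= + <-]; rewrite in_itv /= => /andP[e0 ed].
have l0 : 0 < `|ln e| by rewrite normr_gt0 lt_eqF// ln_lt0// e0 (lt_trans ed).
by rewrite lee_pdivlMr// -EFinM H// e0.
Qed.

Lemma lower_mdim_lt Z (b : R) : (b%:E < lower_mdim f Z)%E ->
  exists2 d, 0 < d < 1 & forall e, 0 < e < d -> ((b * `|ln e|)%:E < entropy_at f Z e)%E.
Proof.
rewrite /lower_mdim limf_einfE => /ereal_sup_gt[_ [V V0 <-] bV].
move: V0 => [d /= d0 dV]; exists (Num.min d (1 / 2)).
  by rewrite lt_min d0 gt_min divr_gt0//= orbC; apply/orP; left; lra.
move=> e /andP[e0]; rewrite lt_min => /andP[ed e1].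
have l0 : 0 < `|ln e| by rewrite normr_gt0 lt_eqF// ln_lt0// e0 /=; lra.
have Ve : V e by apply: dV => //=; rewrite sub0r normrN gtr0_norm.
have : (b%:E < entropy_at f Z e * (`|ln e|^-1)%:E)%E.
  by apply: lt_le_trans bV _; apply: ereal_inf_lbound; exists e.
by rewrite lte_pdivlMr// -EFinM.
Qed.

Lemma lower_mdim_ge0 Z : Z !=set0 -> (0 <= lower_mdim f Z)%E.
Proof.
move=> Z0; apply: lower_mdim_ge; exists (1 / 2); first by apply/andP; split; lra.
by move=> e _; rewrite mul0r entropy_ge0.
Qed.

End lower_mdim.

Lemma convex_comb_le_ereal (R : realType) (t : R) (g1 g2 g : \bar R) :
  0 < t < 1 -> (0 <= g1)%E -> (0 <= g2)%E ->
  (forall b1 b2 : R, (b1%:E < g1)%E -> (b2%:E < g2)%E ->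
     ((t * b1 + (1 - t) * b2)%:E <= g)%E) ->
  (t%:E * g1 + (1 - t)%:E * g2 <= g)%E.
Proof.
move=> /andP[t0 t1] g10 g20 H; have t1' : 0 < 1 - t by rewrite subr_gt0.
have below (x : \bar R) : (0 <= x)%E -> ((-1)%:E < x)%E.
  by apply: lt_le_trans; rewrite lte_fin ltrN10.
case: g1 g10 H => [r1| |] // g10 H; last first.
  rewrite (@eq_infty _ g) ?leey// => b.
  have := H ((b + (1 - t)) / t) (-1) (ltry _) (below _ g20).
  by rewrite mulrC divfK ?gt_eqF// mulrN1 addrK.
case: g2 g20 H => [r2| |] // g20 H; last first.
  rewrite (@eq_infty _ g) ?leey// => b.
  have := H (-1) ((b + t) / (1 - t)) (below _ g10) (ltry _).
  by rewrite (mulrC (1 - t)) divfK ?gt_eqF// mulrN1 addrCA addNr addr0.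
rewrite -!EFinM -EFinD; apply/lee_subgt0Pr => eta eta0; rewrite -EFinB.
have -> : t * r1 + (1 - t) * r2 - eta = t * (r1 - eta) + (1 - t) * (r2 - eta) by ring.
by apply: H; rewrite lte_fin ltrBlDr ltrDl.
Qed.

Section concavity.
Variables (R : realType) (X : metricType R) (f : X -> X) (phi : X -> R).
Hypothesis cX : compact [set: X].
Hypothesis cf : continuous f.
Hypothesis specf : specification f.
Hypothesis cphi : continuous phi.

(** For a slope [b - eta] below [b := t * b1 + (1 - t) * b2], the shift by [ln 8]
    in [`|ln (8 * e)| = `|ln e| - ln 8] is absorbed as soon as
    [eta * `|ln e| >= b * ln 8]. *)
Lemma lower_mdim_concave a1 a2 t : 0 < t < 1 ->
  level_set f phi a1 !=set0 -> level_set f phi a2 !=set0 ->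
  (t%:E * lower_mdim f (level_set f phi a1) +
     (1 - t)%:E * lower_mdim f (level_set f phi a2) <=
   lower_mdim f (level_set f phi (t * a1 + (1 - t) * a2)))%E.
Proof.
move=> t01 K1 K2; have K3 := level_set_convex cX cf specf cphi t01 K1 K2.
apply: (convex_comb_le_ereal t01 (lower_mdim_ge0 f K1) (lower_mdim_ge0 f K2)) => b1 b2.
move=> /lower_mdim_lt[d1 /andP[d10 _] H1] /lower_mdim_lt[d2 /andP[d20 _] H2].
set b := t * b1 + (1 - t) * b2.
apply/lee_subgt0Pr => eta eta0; rewrite -EFinB.
have [bneg|bpos] := leP (b - eta) 0.
  by apply: le_trans (lower_mdim_ge0 f K3); rewrite lee_fin.
pose L := b * ln 8 / eta.
have ln8 : 0 < ln 8 :> R by rewrite ln_gt0// ltr1n.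
have L0 : 0 < L by rewrite divr_gt0// mulr_gt0//; lra.
apply: lower_mdim_ge.
exists (Num.min (expR (- L)) (Num.min (d1 / 8) (Num.min (d2 / 8) (1 / 8)))).
  rewrite !lt_min expR_gt0 !divr_gt0//= gt_min; apply/orP; left.
  by rewrite -expR0 ltr_expR oppr_lt0.
move=> e /andP[e0]; rewrite !lt_min => /and4P[eL ed1 ed2 e8].
have e80 : 0 < 8 * e by rewrite mulr_gt0.
have := entropy_concave cX cf specf cphi e80 t01
  (H1 (8 * e) _) (H2 (8 * e) _); rewrite -/b.
have -> : 8 * e / 8 = e by rewrite mulrAC divff ?mul1r// pnatr_eq0.
move=> /(_ _ _)/(le_trans _); apply; last 2 first.
- by rewrite e80 mulrC -ltr_pdivlMr.
- by rewrite e80 mulrC -ltr_pdivlMr.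
have lne : ln e < - L by rewrite -ltr_expR lnK.
have ln8e : ln (8 * e) < 0 by apply: ln_lt0; rewrite e80 mulrC -ltr_pdivlMr.
rewrite (ltr0_norm ln8e) ltr0_norm; last by apply: lt_trans lne _; rewrite oppr_lt0.
rewrite lee_fin lnM ?posrE//.
have -> : t * (b1 * - (ln 8 + ln e)) + (1 - t) * (b2 * - (ln 8 + ln e)) =
  b * - (ln 8 + ln e) by rewrite /b; ring.
have : eta * L <= eta * - ln e by rewrite ler_pM2l// lerNr ltW.
rewrite /L (mulrC eta) divfK ?gt_eqF//.
move: (ln e) (ln 8) => u v h.
rewrite -subr_ge0.
have -> : b * - (v + u) - (b - eta) * - u = eta * - u - b * v by ring.
by rewrite subr_ge0.
Qed.

End concavity.

Theorem corollary2p3 (R : realType) (X : metricType R) (f : X -> X)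
  (phi : X -> R) :
  compact [set: X] -> continuous f -> specification f -> continuous phi ->
  is_interval (level_values f phi) /\
  concave_on (level_values f phi)
    (fun alpha => lower_mdim f (level_set f phi alpha)).
Proof.
move=> cX cf specf cphi; split.
  apply/is_intervalPlt => x y Kx Ky z /andP[xz zy].
  have xy : 0 < y - x by rewrite subr_gt0 (lt_trans xz).
  have -> : z = (y - z) / (y - x) * x + (1 - (y - z) / (y - x)) * y.
    by field; rewrite gt_eqF.
  apply: level_set_convex => //.
  have yz : 0 < y - z by rewrite subr_gt0.
  by rewrite (divr_gt0 yz xy) ltr_pdivrMr// mul1r ltrD2l ltrN2.
move=> a1 a2 t K1 K2 /andP[]; rewrite le_eqVlt => /predU1P[<-|t0].
  by rewrite mul0e add0e subr0 mul1e mul0r add0r mul1r.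
rewrite le_eqVlt => /predU1P[->|t1].
  by rewrite subrr mul0e adde0 mul1e mul0r addr0 mul1r.
by apply: lower_mdim_concave => //; rewrite t0.
Qed.
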